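(* Let $M$ be a non-cylindrical, nondegenerate, ruled surface of $\mathbb{L}^3$, parametrized by $X(s,t)=\gamma(s)+t\beta(s)$, such that $\beta$ is a lightlike vector field parametrized by arc length, i.e. such that $\langle\beta'(s),\beta'(s)\rangle=1$. If $M$ is a homothetic self-similar solution of the inverse mean curvature flow (with constant $C\in\mathbb{R}\setminus\{0\}$), then (i) $M$ is a timelike self-expander with $C=1$; (ii) $\gamma(s)=a(s)\beta(s)+b(s)\beta'(s)$, where $a(s)$ and $b(s)\neq0$ are real smooth functions; (iii) $(\beta''(s),\beta(s),\beta'(s))=1$. Conversely, let $M$ be a ruled surface parametrized by $X(s,t)=\gamma(s)+t\beta(s)$, where $\beta(s)$ is a lightlike vector field parametrized by arc length. If $\beta$ and $\gamma$ satisfy (ii) and (iii), for any real functions $a(s)$ and $b(s)\neq0$, then $M$ is a timelike self-expander of the inverse mean curvature flow with $C=1$.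
   Context: $\mathbb{L}^3$ is $\mathbb{R}^3$ with the metric $\langle x,y\rangle=x_1y_1+x_2y_2-x_3y_3$. A vector $v$ is spacelike if $\langle v,v\rangle>0$ or $v=0$, timelike if $\langle v,v\rangle<0$, lightlike if $\langle v,v\rangle=0$ and $v\neq0$; a vector field $\beta$ is lightlike if $\beta(s)$ is lightlike for all $s$. The vector product $u\times v$ is defined by $\langle u\times v,x\rangle=\det(x,u,v)$ for all $x$, and the mixed product is $(u,v,w)=\langle u\times v,w\rangle=\det(u,v,w)$. For $v\in\mathbb{L}^3$, $|v|=\sqrt{|\langle v,v\rangle|}$. For a surface with local parametrization $X(s,t)$ put $E=\langle X_s,X_s\rangle$, $F=\langle X_s,X_t\rangle$, $G=\langle X_t,X_t\rangle$. The surface is nondegenerate if $EG-F^2\neq0$ at all its points. It has unit normals $N=\pm\frac{X_s\times X_t}{|X_s\times X_t|}$, with $\langle N,N\rangle=\epsilon$, where $\epsilon=-1$ if the surface is spacelike (induced metric positive definite) and $\epsilon=1$ if it is timelike (induced metric indefinite and nondegenerate). The mean curvature is $H=\frac{\epsilon}{2}\,\frac{\langle N,X_{ss}\rangle G-2\langle N,X_{st}\rangle F+\langle N,X_{tt}\rangle E}{EG-F^2}$. An immersion $X$ of a nondegenerate surface $M$ with nonzero mean curvature is a homothetic self-similar solution of the inverse mean curvature flow $\partial_tX=-\frac1HN$ if, for some positive function $\phi$ with $\phi(0)=1$, the family $\phi(t)X$ is a solution of the flow; this is expressed equivalently by the equation $C\langle N,X\rangle=-\frac1H$ for some constant $C\in\mathbb{R}\setminus\{0\}$,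 which is the constant $C$ in the statement. $M$ is a self-shrinker if $\epsilon C<0$ and a self-expander if $\epsilon C>0$. A ruled surface is one parametrized locally by $X(s,t)=\gamma(s)+t\beta(s)$, where $\gamma$ is a smooth regular curve defined on an interval $I$ and $\beta$ is a smooth vector field along $\gamma$; it is non-cylindrical if $\beta'(s)\neq0$ on $I$.
   Formalization: Conclusion (iii) is false as printed (take β=(cos s, −sin s, 1), γ=β′: the mixed product is −1); it is proved up to orientation of s: (β″,β,β′)=1 on all of I either for β(s) or for the reversed parametrization β(−s). *)

(* Defs.v *)
From mathcomp Require Import all_boot all_order all_algebra.
From mathcomp Require Import all_classical all_reals all_analysis.
From mathcomp Require Import ring.

Set Implicit Arguments.
Unset Strict Implicit.
Unset Printing Implicit Defensive.

Import Order.TTheory GRing.Theory Num.Theory.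
Import numFieldNormedType.Exports.

Local Open Scope classical_set_scope.
Local Open Scope ring_scope.

(* Coordinates x_1, x_2, x_3 are the entries 0, 1, 2 of a row vector. *)
Definition lprod (R : realType) (x y : 'rV[R]_3) : R :=
  x 0 0 * y 0 0 + x 0 1 * y 0 1 - x 0 2 * y 0 2.

Definition lnorm (R : realType) (v : 'rV[R]_3) : R := Num.sqrt `|lprod v v|.

Definition lightlike (R : realType) (v : 'rV[R]_3) : Prop :=
  lprod v v = 0 /\ v != 0.

Definition det3 (R : realType) (u v w : 'rV[R]_3) : R :=
  \det (\matrix_(i < 3) nth 0 [:: u; v; w] i).

Definition basis_vec (R : realType) (i : 'I_3) : 'rV[R]_3 := delta_mx 0 i.

(* The metric is diag(1, 1, -1), so the third coordinate of u x v is minus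
   <u x v, e_3>; see lprod_lcross for the defining property. *)
Definition lcross (R : realType) (u v : 'rV[R]_3) : 'rV[R]_3 :=
  \row_(i < 3) (lprod (basis_vec R i) (basis_vec R i) * det3 (basis_vec R i) u v).

Definition mixed (R : realType) (u v w : 'rV[R]_3) : R := lprod (lcross u v) w.

Lemma det3E (R : realType) (u v w : 'rV[R]_3) :
  det3 u v w = u 0 0 * (v 0 1 * w 0 2 - v 0 2 * w 0 1)
             - u 0 1 * (v 0 0 * w 0 2 - v 0 2 * w 0 0)
             + u 0 2 * (v 0 0 * w 0 1 - v 0 1 * w 0 0).
Proof.
rewrite /det3 (expand_det_row _ ord0) !big_ord_recl big_ord0 /cofactor.
rewrite !(expand_det_row _ ord0) !big_ord_recl !big_ord0 /cofactor.
rewrite !det_mx11 !mxE /=.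
have [f fE] : exists f : 'rV[R]_3 -> nat -> R,
    forall (x : 'rV[R]_3) (k : 'I_3), x 0 k = f x k.
  by exists (fun x n => x 0 (inord n)) => x k; rewrite inord_val.
by rewrite !fE /= /bump /=; ring.
Qed.

Lemma lprod_lcross (R : realType) (u v x : 'rV[R]_3) :
  lprod (lcross u v) x = det3 x u v.
Proof. by rewrite /lprod !mxE !det3E /basis_vec /lprod !mxE /=; ring. Qed.

Lemma mixedE (R : realType) (u v w : 'rV[R]_3) : mixed u v w = det3 u v w.
Proof. by rewrite /mixed lprod_lcross !det3E; ring. Qed.

Definition open_interval (R : realType) (I : set R) : Prop :=
  [/\ open I, is_interval I & I !=set0].

Definition smooth_on (R : realType) (V : normedModType R) (I : set R)
    (f : R -> V) : Prop :=
  forall (n : nat) (s : R), I s -> derivable (derive1n n f) s 1.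

Section Surface.
Context (R : realType).
Implicit Types (X : R -> R -> 'rV[R]_3) (s t C : R) (I J : set R) (o : bool).

Definition d_s X s t : 'rV[R]_3 := derive1 (fun s' => X s' t) s.
Definition d_t X s t : 'rV[R]_3 := derive1 (X s) t.

Definition coefE X s t : R := lprod (d_s X s t) (d_s X s t).
Definition coefF X s t : R := lprod (d_s X s t) (d_t X s t).
Definition coefG X s t : R := lprod (d_t X s t) (d_t X s t).
Definition gram X s t : R :=
  coefE X s t * coefG X s t - coefF X s t ^+ 2.

Definition nondegenerate_surface I J X : Prop :=
  forall s t, I s -> J t -> gram X s t != 0.

Definition tangent X s t (x y : R) : 'rV[R]_3 :=
  x *: d_s X s t + y *: d_t X s t.

Definition timelike_surface I J X : Prop :=
  nondegenerate_surface I J X /\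
  forall s t, I s -> J t ->
    (exists x y, 0 < lprod (tangent X s t x y) (tangent X s t x y)) /\
    (exists x y, lprod (tangent X s t x y) (tangent X s t x y) < 0).

(* The boolean o selects one of the two unit normals. *)
Definition unit_normal o X s t : 'rV[R]_3 :=
  (-1) ^+ o *: ((lnorm (lcross (d_s X s t) (d_t X s t)))^-1
                *: lcross (d_s X s t) (d_t X s t)).

(* This is -1 on spacelike surfaces and 1 on timelike ones. *)
Definition epsilon o X s t : R :=
  lprod (unit_normal o X s t) (unit_normal o X s t).

Definition mean_curvature o X s t : R :=
  let N := unit_normal o X s t in
  epsilon o X s t / 2 *
  ((lprod N (d_s (d_s X) s t) * coefG X s t
    - 2 * lprod N (d_t (d_s X) s t) * coefF X s t
    + lprod N (d_t (d_t X) s t) * coefE X s t) / gram X s t).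

(* For the flow d_t X = - N / H, read up to tangential motion, a positive family
   phi(t) X with phi(0) = 1 is a solution iff this equation holds for some C. *)
Definition self_similar_IMCF I J o X C : Prop :=
  [/\ C != 0, nondegenerate_surface I J X &
   forall s t, I s -> J t ->
     mean_curvature o X s t != 0 /\
     C * lprod (unit_normal o X s t) (X s t) = - (mean_curvature o X s t)^-1].

Definition self_expander_IMCF I J o X C : Prop :=
  self_similar_IMCF I J o X C /\
  forall s t, I s -> J t -> 0 < epsilon o X s t * C.

Implicit Types (gamma beta : R -> 'rV[R]_3) (a b : R -> R).

Definition ruled gamma beta s t : 'rV[R]_3 := gamma s + t *: beta s.

Definition ruled_data I gamma beta : Prop :=
  [/\ smooth_on I gamma, smooth_on I beta &
   forall s, I s -> derive1 gamma s != 0].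

Definition non_cylindrical I beta : Prop :=
  forall s, I s -> derive1 beta s != 0.

Definition lightlike_arclength I beta : Prop :=
  forall s, I s ->
    lightlike (beta s) /\ lprod (derive1 beta s) (derive1 beta s) = 1.

Definition frame_decomposition I gamma beta a b : Prop :=
  forall s, I s ->
    b s != 0 /\ gamma s = a s *: beta s + b s *: derive1 beta s.

Definition unit_mixed I beta : Prop :=
  forall s, I s -> mixed (derive1n 2 beta s) (beta s) (derive1 beta s) = 1.

(* Substituting -s for s preserves the ruling and the arc-length condition
   but changes the sign of (beta'', beta, beta'); this is [unit_mixed]
   for a suitable orientation of the parameter. *)
Definition unit_mixed_oriented I beta : Prop :=
  unit_mixed I beta \/ unit_mixed [set s | I (- s)] (fun s => beta (- s)).

End Surface.

(* Main.v *)
Require Import Defs.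
From mathcomp Require Import all_boot all_order all_algebra.
From mathcomp Require Import all_classical all_reals all_analysis.
From mathcomp Require Import ring.

(** Write u = beta, v = beta', w = beta'' at a parameter s.  Differentiating
    <u,u> = 0 and <v,v> = 1 gives <u,v> = 0, <u,w> = -1 and <v,w> = 0.  The
    metric has determinant -1, so a product of two triple determinants is minus
    a Gram determinant ([det3M_gram]).  Two consequences carry the proof: with
    mu = det(w,u,v) one has mu^2 = 1 ([null_frame_det2]), and
    det(x,u,v) = - mu <x,u> for every x ([null_frame_det]).  In other words,
    u x v is a multiple of the null vector u itself.

    On the ruled surface, G = 0 because the rulings are lightlike, and
    F = <gamma',u> does not depend on t.  The Gram determinant is thus -F^2:
    nondegenerate means F <> 0, and such a surface is timelike, with
    epsilon = 1.  The terms of H that contain second derivatives of gamma or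
    of beta are multiplied by G, hence H = -+ mu/|F|, which never vanishes,
    and the self-similarity equation becomes ([self_similar_ruledE])
      C (det(gamma,gamma',u) + t mu <gamma,u>) = mu F^2.

    The right-hand side does not depend on t, so two values of t force
    <gamma,u> = 0.  Conversely, assume <gamma,u> = 0.  Then gamma lies in the
    span of u and v, with smooth coordinates -<gamma,w> and <gamma,v>;
    differentiating, F = - <gamma,v>, and det(gamma,gamma',u) = mu F^2
    ([orthogonal_det]).  The equation is now C mu F^2 = mu F^2, that is C = 1.
    A curve gamma = a u + b v with b <> 0 is orthogonal to u and has F = -b,
    which is the converse direction.

    Finally mu is continuous with square 1 on an interval, so it is constantly
    1 or constantly -1; reversing the parameter turns -1 into 1. *)

Set Implicit Arguments.
Unset Strict Implicit.
Unset Printing Implicit Defensive.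

Import Order.TTheory GRing.Theory Num.Theory.
Import numFieldNormedType.Exports.

Local Open Scope classical_set_scope.
Local Open Scope ring_scope.

(** * The Lorentzian product and determinants *)

Lemma lprodC (R : realType) (x y : 'rV[R]_3) : lprod x y = lprod y x.
Proof. by rewrite /lprod; ring. Qed.

Lemma lprodDl (R : realType) (x y z : 'rV[R]_3) :
  lprod (x + y) z = lprod x z + lprod y z.
Proof. by rewrite /lprod !mxE; ring. Qed.

Lemma lprodZl (R : realType) (c : R) (x y : 'rV[R]_3) :
  lprod (c *: x) y = c * lprod x y.
Proof. by rewrite /lprod !mxE; ring. Qed.

Lemma lprodNl (R : realType) (x y : 'rV[R]_3) : lprod (- x) y = - lprod x y.
Proof. by rewrite /lprod !mxE; ring. Qed.

Lemma lprodZr (R : realType) (c : R) (x y : 'rV[R]_3) :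
  lprod x (c *: y) = c * lprod x y.
Proof. by rewrite lprodC lprodZl lprodC. Qed.

Lemma lprod_comb2 (R : realType) (x y : R) (p q : 'rV[R]_3) :
  lprod (x *: p + y *: q) (x *: p + y *: q) =
  x ^+ 2 * lprod p p + 2 * (x * y) * lprod p q + y ^+ 2 * lprod q q.
Proof. by rewrite /lprod !mxE; ring. Qed.

Lemma lprod0l (R : realType) (x : 'rV[R]_3) : lprod 0 x = 0.
Proof. by rewrite /lprod !mxE; ring. Qed.

Lemma lprod_lcross2 (R : realType) (x y : 'rV[R]_3) :
  lprod (lcross x y) (lcross x y) = lprod x y ^+ 2 - lprod x x * lprod y y.
Proof.
by rewrite lprod_lcross det3E /lprod !mxE !det3E /basis_vec /lprod !mxE /=; ring.
Qed.

Lemma det3Nr (R : realType) (x y z : 'rV[R]_3) :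
  det3 x y (- z) = - det3 x y z.
Proof. by rewrite !det3E !mxE; ring. Qed.

(** Multiplicativity of determinants: with J = diag(1,1,-1), the matrix of
    products is A J B^T, whose determinant is - det A det B. *)
Lemma det3M_gram (R : realType) (x y u v : 'rV[R]_3) :
  det3 x u v * det3 y u v =
  - (lprod x y * (lprod u u * lprod v v - lprod u v ^+ 2)
     - lprod x u * (lprod u y * lprod v v - lprod u v * lprod v y)
     + lprod x v * (lprod u y * lprod u v - lprod u u * lprod v y)).
Proof. by rewrite !det3E /lprod; ring. Qed.

(** Cramer's rule without division: the four vectors live in dimension 3. *)
Lemma det3_cramer (R : realType) (g u v w : 'rV[R]_3) :
  det3 w u v *: g =
  det3 w g v *: u + det3 w u g *: v + det3 g u v *: w.
Proof.
apply/rowP => -[[|[|[|//]]] i3]; rewrite !mxE !det3E.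
- rewrite (_ : Ordinal i3 = 0); [ring|exact: val_inj].
- rewrite (_ : Ordinal i3 = 1); [ring|exact: val_inj].
- rewrite (_ : Ordinal i3 = 2); [ring|exact: val_inj].
Qed.

(** The next three expansions are stated for arbitrary vectors, in the shapes
    taken by the velocity [p + t *: v] and the position [g + t *: u] of a
    ruled surface, and by a base curve [a *: u + b *: v] in the plane spanned
    by the ruling and its derivative. *)
Lemma det3_ruled_velocity (R : realType) (t : R) (p u v : 'rV[R]_3) :
  det3 v (p + t *: v) u = det3 p u v.
Proof. by rewrite !det3E !mxE; ring. Qed.

Lemma det3_ruled_position (R : realType) (t : R) (g p u v : 'rV[R]_3) :
  det3 (g + t *: u) (p + t *: v) u = det3 g p u - t * det3 g u v.
Proof. by rewrite !det3E !mxE; ring. Qed.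

Lemma det3_null_position (R : realType) (a b : R) (p u v : 'rV[R]_3) :
  det3 (a *: u + b *: v) p u = b * det3 p u v.
Proof. by rewrite !det3E !mxE; ring. Qed.

(** * Frames containing a null vector and a unit vector *)

Section NullFrame.
Context {R : realType} {u v w : 'rV[R]_3}.
Hypotheses (uu : lprod u u = 0) (uv : lprod u v = 0) (vv : lprod v v = 1).
Hypothesis (uw : lprod u w = -1).

(** The square is minus the Gram determinant of [w], [u], [v].  The row of [u]
    in the Gram matrix is (-1, 0, 0), so that determinant is
    [- <u,w>^2 <v,v> = -1]. *)
Lemma null_frame_det2 : det3 w u v ^+ 2 = 1.
Proof. by rewrite expr2 det3M_gram uu uv vv uw (lprodC w u) uw; ring. Qed.

Lemma null_frame_det_neq0 : det3 w u v != 0.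
Proof. by rewrite -sqrf_eq0 null_frame_det2 oner_neq0. Qed.

(** The plane of [u] and [v] is degenerate with radical [u], so its normal
    [u x v] is proportional to [u]; pairing with [w] gives the factor. *)
Lemma null_frame_det (x : 'rV[R]_3) :
  det3 x u v = - det3 w u v * lprod x u.
Proof.
apply: (mulIf null_frame_det_neq0).
rewrite mulrAC mulNr -expr2 null_frame_det2 det3M_gram uu uv vv uw; ring.
Qed.

(** By [null_frame_det], orthogonality to [u] means lying in the span of [u]
    and [v]; the coordinates are then read off by pairing with [w] and [v]. *)
Lemma null_frame_coords (vw : lprod v w = 0) (g : 'rV[R]_3) :
  lprod g u = 0 -> g = - lprod g w *: u + lprod g v *: v.
Proof.
move=> gu; have := det3_cramer g u v w.
rewrite (null_frame_det g) gu mulr0 scale0r addr0 => gE.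
have {}gE : g = (det3 w u v)^-1 * det3 w g v *: u
                + (det3 w u v)^-1 * det3 w u g *: v.
  by rewrite -!scalerA -scalerDr -gE scalerA mulVf ?scale1r// null_frame_det_neq0.
set x := _^-1 * _ in gE; set y := _^-1 * _ in gE.
have -> : lprod g v = y by rewrite gE lprodDl !lprodZl uv vv; ring.
have -> : lprod g w = - x by rewrite gE lprodDl !lprodZl uw vw; ring.
by rewrite opprK.
Qed.

End NullFrame.

(** * Derivatives of vector-valued functions *)

Lemma is_derive1E (R : realType) (V : normedModType R) (f : R -> V) (s : R) :
  derivable f s 1 -> is_derive s 1 f (derive1 f s).
Proof. by move=> df; rewrite derive1E; exact: derivableP. Qed.

Lemma is_derive_coord (R : realType) n (f : R -> 'rV[R]_n) (s : R) df i :
  is_derive s 1 f df -> is_derive s 1 (fun x => f x 0 i) (df 0 i).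
Proof.
move=> [fs <-]; apply: DeriveDef; first exact: (derivable_mxP f s 1).1.
by rewrite derive_mx // mxE.
Qed.

Lemma is_derive_lprod (R : realType) (f g : R -> 'rV[R]_3) (s : R) df dg :
  is_derive s 1 f df -> is_derive s 1 g dg ->
  is_derive s 1 (fun x => lprod (f x) (g x)) (lprod df (g s) + lprod (f s) dg).
Proof.
move=> fs gs.
have fi i := is_derive_coord i fs.
have gi i := is_derive_coord i gs.
have h := is_deriveB (is_deriveD (is_deriveM (fi 0) (gi 0))
  (is_deriveM (fi 1) (gi 1))) (is_deriveM (fi 2) (gi 2)).
apply: (trigger_derive h); rewrite /lprod /GRing.scale /=; ring.
Qed.

Lemma cvg_det3 (R : realType) (f g h : R -> 'rV[R]_3) (s : R) :
  {for s, continuous f} -> {for s, continuous g} -> {for s, continuous h} ->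
  {for s, continuous (fun x => det3 (f x) (g x) (h x))}.
Proof.
have co (k : R -> 'rV[R]_3) i : {for s, continuous k} ->
    k x 0 i @[x --> s] --> k s 0 i.
  move=> ks; apply: (@cvg_comp _ _ _ k (fun M : 'rV_3 => M 0 i) _ (nbhs (k s))).
    exact: ks.
  exact: coord_continuous.
move=> fs gs hs.
rewrite /prop_for /continuous_at det3E; under eq_fun do rewrite det3E.
apply: cvgD; [apply: cvgB|]; apply: cvgM; try exact: co;
  by apply: cvgB; apply: cvgM; exact: co.
Qed.

Lemma derivable_cont (R : realType) (V : normedModType R) (f : R -> V) (s : R) :
  derivable f s 1 -> {for s, continuous f}.
Proof. by move=> /derivable1_diffP/differentiable_continuous. Qed.

Lemma derive1_opp (R : realType) (V : normedModType R) (f : R -> V) (s : R) :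
  derivable f (- s) 1 -> derive1 (fun x => f (- x)) s = - derive1 f (- s).
Proof.
move=> /derivable1_diffP fs.
have ds : differentiable (-%R : R -> R) s.
  by apply/derivable1_diffP; exact: derivable_opp.
rewrite [LHS]derive1E'; last exact: (differentiable_comp ds).
rewrite (diff_comp ds) //= derive1E' // -linearN; congr ('d f _ _).
by rewrite -deriveE // derive_val.
Qed.

(** Between values of opposite signs, the intermediate value theorem would
    produce a zero, whose square is not 1. *)
Lemma sqr1_constant_sign (R : realType) (I : set R) (f : R -> R) :
  is_interval I -> (forall s, I s -> {for s, continuous f}) ->
  (forall s, I s -> f s ^+ 2 = 1) ->
  (forall s, I s -> f s = 1) \/ (forall s, I s -> f s = -1).
Proof.
move=> iI cont f2.
have f1 s : I s -> f s = 1 \/ f s = -1.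
  by move=> /f2 /eqP; rewrite sqrf_eq1 => /orP[] /eqP ->; [left|right].
have no_jump x y : I x -> I y -> x <= y -> f x = f y.
  move=> Ix Iy xy.
  have sub z : z \in `[x, y] -> I z.
    by rewrite in_itv /= => /andP[xz zy]; apply: (iI x y) => //; rewrite xz zy.
  have no_zero : Num.min (f x) (f y) <= 0 <= Num.max (f x) (f y) -> False.
    move=> h; have [|z /sub Iz z0] := IVT xy _ h.
      apply: continuous_in_subspaceT => z; rewrite inE /= => /sub; exact: cont.
    by have /eqP := f2 z Iz; rewrite z0 expr0n /= eq_sym oner_eq0.
  have N10 : -1 <= 0 :> R := lerN10 R.
  have N11 : -1 <= 1 :> R := le_trans N10 ler01.
  case: (f1 x Ix) (f1 y Iy) => [] ex [] ey; rewrite ex ey //;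
    exfalso; apply: no_zero; rewrite ex ey.
  - by rewrite (min_idPr N11) (max_idPl N11) N10 ler01.
  - by rewrite (min_idPl N11) (max_idPr N11) N10 ler01.
have const x y : I x -> I y -> f x = f y.
  move=> Ix Iy; have [xy|/ltW yx] := leP x y; first exact: no_jump.
  by apply/esym/no_jump.
have [[s0 Is0]|I0] := pselect (exists s, I s); last first.
  by left => s Is; case: I0; exists s.
by case: (f1 s0 Is0) => e; [left|right] => s Is; rewrite (const s s0).
Qed.

(** * Smooth functions on an open set *)

Section OpenDomain.
Context {R : realType} {I : set R} (oI : open I).

Lemma near_open (P : R -> Prop) s : I s -> (forall x, I x -> P x) ->
  \forall x \near s, P x.
Proof. by move=> Is IP; apply: filterS IP _; exact: open_nbhs_nbhs. Qed.

Lemma derive1_eq_on (V : normedModType R) (f g : R -> V) s : I s ->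
  (forall x, I x -> f x = g x) -> derive1 f s = derive1 g s.
Proof.
by move=> Is fg; rewrite !derive1E; apply: near_eq_derive; exact: near_open.
Qed.

Lemma derive1n_eq_on (V : normedModType R) (f g : R -> V) n :
  (forall x, I x -> f x = g x) ->
  forall x, I x -> derive1n n f x = derive1n n g x.
Proof.
move=> fg; elim: n => [//|n IHn] x Ix.
by rewrite !derive1nS; exact: derive1_eq_on.
Qed.

Lemma derivable_eq_on (V : normedModType R) (f g : R -> V) s : I s ->
  (forall x, I x -> f x = g x) -> derivable f s 1 -> derivable g s 1.
Proof.
by move=> Is fg; apply: near_eq_derivable; exact: (near_open (P := fun x => f x = g x)).
Qed.

(** A coinduction principle for smoothness: a class of differentiable functions
    that is stable under derivation, up to equality on [I], consists of smooth
    functions.  It avoids computing higher derivatives of a product. *)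
Lemma smooth_onI (V : normedModType R) (Q : (R -> V) -> Prop) :
  (forall f, Q f -> (forall s, I s -> derivable f s 1) /\
     exists2 g, Q g & forall s, I s -> derive1 f s = g s) ->
  forall f, Q f -> smooth_on I f.
Proof.
move=> QP f + n; elim: n f => [|n IHn] f Qf s Is; first exact: (QP _ Qf).1.
have [_ [g Qg fg]] := QP _ Qf.
rewrite derive1Sn; apply: (derivable_eq_on (f := derive1n n g)) => //.
  by move=> x Ix; apply: derive1n_eq_on => // y Iy; rewrite fg.
exact: IHn.
Qed.

Lemma smooth_on_derivable {V : normedModType R} {f : R -> V} {s} :
  smooth_on I f -> I s -> derivable f s 1.
Proof. by move=> /(_ 0%N) ; exact. Qed.

Lemma smooth_on_derive1 (V : normedModType R) (f : R -> V) :
  smooth_on I f -> smooth_on I (derive1 f).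
Proof. by move=> fI n s; rewrite -derive1Sn; exact: fI. Qed.

Lemma smooth_onN (V : normedModType R) (f : R -> V) :
  smooth_on I f -> smooth_on I (fun s => - f s).
Proof.
move=> fI.
apply: (smooth_onI (Q := [set h | exists2 f, smooth_on I f & h = fun s => - f s])).
  move=> _ [g gI ->]; split => [s Is|].
    by apply: derivableN; exact: smooth_on_derivable.
  exists (fun s => - derive1 g s).
    by exists (derive1 g) => //; exact: smooth_on_derive1.
  move=> s Is; rewrite !derive1E -deriveN //; exact: smooth_on_derivable.
by exists f.
Qed.

(** Sums are included because the Leibniz rule turns a product into a sum of
    two products; with them the class is stable under derivation. *)
Inductive lprod_sum : (R -> R) -> Prop :=
| LprodSum1 f g : smooth_on I f -> smooth_on I g ->
    lprod_sum (fun s => lprod (f s) (g s))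
| LprodSumD h k : lprod_sum h -> lprod_sum k -> lprod_sum (h + k).

Lemma lprod_sum_derive1 (h : R -> R) : lprod_sum h ->
  (forall s, I s -> derivable h s 1) /\
  exists2 k, lprod_sum k & forall s, I s -> derive1 h s = k s.
Proof.
elim=> [f g fI gI|h1 h2 _ [d1 [k1 Qk1 E1]] _ [d2 [k2 Qk2 E2]]].
  have d s (Is : I s) := is_derive_lprod
    (is_derive1E (smooth_on_derivable fI Is))
    (is_derive1E (smooth_on_derivable gI Is)).
  split => [s /d[]//|].
  exists ((fun s => lprod (derive1 f s) (g s)) +
          (fun s => lprod (f s) (derive1 g s))).
    exact: LprodSumD (LprodSum1 (smooth_on_derive1 fI) gI)
                     (LprodSum1 fI (smooth_on_derive1 gI)).
  by move=> s /d[_ E]; rewrite derive1E E.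
split => [s Is|]; first by apply: derivableD; [exact: d1|exact: d2].
exists (k1 + k2); first exact: LprodSumD Qk1 Qk2.
move=> s Is; rewrite derive1E deriveD; [|exact: d1|exact: d2].
by rewrite -!derive1E E1 // E2.
Qed.

Lemma smooth_on_lprod (f g : R -> 'rV[R]_3) :
  smooth_on I f -> smooth_on I g -> smooth_on I (fun s => lprod (f s) (g s)).
Proof.
move=> fI gI; apply: (smooth_onI lprod_sum_derive1); exact: LprodSum1.
Qed.

(** Applied in turn to [<beta,beta>], [<beta,beta'>], [<beta',beta'>] and
    [<gamma,beta>], this produces all the differential relations of the
    proof. *)
Lemma lprod_leibniz_on (f g : R -> 'rV[R]_3) (c s : R) :
  smooth_on I f -> smooth_on I g ->
  (forall x, I x -> lprod (f x) (g x) = c) -> I s ->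
  lprod (derive1 f s) (g s) + lprod (f s) (derive1 g s) = 0.
Proof.
move=> fI gI fgc Is.
have [_ <-] := is_derive_lprod
  (is_derive1E (smooth_on_derivable fI Is))
  (is_derive1E (smooth_on_derivable gI Is)).
by rewrite -derive1E (derive1_eq_on (g := cst c) Is) // derive1_cst.
Qed.

End OpenDomain.

(** * Geometry of ruled surfaces with lightlike rulings *)

Lemma derive1_affine (R : realType) (V : normedModType R) (a b : V) (t : R) :
  derive1 (fun x : R => a + x *: b) t = b.
Proof.
rewrite derive1E deriveD ?derive_cst ?add0r; last 2 first.
- exact: derivable_cst.
- by apply: diff_derivable.
by rewrite deriveE // diff_val scale1r.
Qed.

Section RuledSurface.
Context {R : realType} {I : set R} {gamma beta : R -> 'rV[R]_3}.
Hypotheses (oI : open I) (smg : smooth_on I gamma) (smb : smooth_on I beta).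
Hypothesis lb : lightlike_arclength I beta.

Local Notation gamma' := (derive1 gamma).
Local Notation beta' := (derive1 beta).
Local Notation beta'' := (derive1 (derive1 beta)).
Local Notation X := (ruled gamma beta).

Local Notation mu s := (det3 (beta'' s) (beta s) (beta' s)).
Local Notation F s := (lprod (gamma' s) (beta s)).

Lemma lightlike_frame {s} : I s ->
  [/\ lprod (beta s) (beta s) = 0, lprod (beta s) (beta' s) = 0,
      lprod (beta' s) (beta' s) = 1, lprod (beta s) (beta'' s) = -1 &
      lprod (beta' s) (beta'' s) = 0].
Proof.
have smb' := smooth_on_derive1 smb.
have half (x : R) : x + x = 0 -> x = 0.
  by move=> /eqP; rewrite -mulr2n mulrn_eq0 => /eqP.
have uu x : I x -> lprod (beta x) (beta x) = 0 by move=> /lb[[]].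
have vv x : I x -> lprod (beta' x) (beta' x) = 1 by move=> /lb[].
have uv x : I x -> lprod (beta x) (beta' x) = 0.
  move=> Ix; apply: half; rewrite -{1}lprodC.
  exact: (lprod_leibniz_on oI smb smb uu).
move=> Is; split; [exact: uu|exact: uv|exact: vv| |].
- have := lprod_leibniz_on oI smb smb' uv Is.
  by rewrite vv // => /eqP; rewrite addrC addr_eq0 => /eqP.
- apply: half; rewrite -{1}lprodC.
  exact: (lprod_leibniz_on oI smb' smb' vv).
Qed.

Lemma lightlike_frame_det {s} : I s -> forall x,
  det3 x (beta s) (beta' s) = - mu s * lprod x (beta s).
Proof. by move=> /lightlike_frame[? ? ? ? _] x; exact: null_frame_det. Qed.

Lemma lightlike_frame_det_sqr {s} : I s -> mu s ^+ 2 = 1.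
Proof. by move=> /lightlike_frame[? ? ? ? _]; exact: null_frame_det2. Qed.

Lemma d_t_ruled s t : d_t X s t = beta s.
Proof. exact: derive1_affine. Qed.

Lemma d_s_ruled s t : I s -> d_s X s t = gamma' s + t *: beta' s.
Proof.
move=> Is; rewrite /d_s derive1E deriveD ?deriveZ -?derive1E //.
- exact: smooth_on_derivable smb Is.
- exact: smooth_on_derivable smg Is.
- by apply: derivableZ; exact: smooth_on_derivable smb Is.
Qed.

Lemma d_t_d_s_ruled s t : I s -> d_t (d_s X) s t = beta' s.
Proof.
move=> Is; rewrite /d_t.
have -> : d_s X s = fun t => gamma' s + t *: beta' s.
  by apply/funext => x; exact: d_s_ruled.
exact: derive1_affine.
Qed.

Lemma d_t_d_t_ruled s t : d_t (d_t X) s t = 0.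
Proof.
rewrite [LHS]/d_t; have -> : d_t X s = cst (beta s).
  by apply/funext => x; exact: d_t_ruled.
exact: derive1_cst.
Qed.

Lemma coefG_ruled s t : I s -> coefG X s t = 0.
Proof. by rewrite /coefG d_t_ruled => /lightlike_frame[]. Qed.

Lemma coefF_ruled s t : I s -> coefF X s t = F s.
Proof.
move=> Is; have [_ uv _ _ _] := lightlike_frame Is.
by rewrite /coefF d_t_ruled d_s_ruled// lprodDl lprodZl (lprodC (beta' s)) uv mulr0 addr0.
Qed.

Lemma gram_ruled s t : I s -> gram X s t = - F s ^+ 2.
Proof. by move=> Is; rewrite /gram coefG_ruled// coefF_ruled// mulr0 add0r. Qed.

Lemma nondegenerate_ruled (J : set R) : (forall s, I s -> F s != 0) ->
  nondegenerate_surface I J X.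
Proof.
by move=> F0 s t Is _; rewrite gram_ruled// oppr_eq0 expf_neq0// F0.
Qed.

(** As [G = 0], the metric evaluated on [X_s + y X_t] is [E + 2 y F], which is
    onto as a function of [y] when [F] is nonzero. *)
Lemma timelike_ruled (J : set R) : (forall s, I s -> F s != 0) ->
  timelike_surface I J X.
Proof.
move=> F0; split=> [|s t Is _]; first exact: nondegenerate_ruled.
have tanE c : lprod
    (tangent X s t 1 ((c - Defs.coefE X s t) / (2 * F s)))
    (tangent X s t 1 ((c - Defs.coefE X s t) / (2 * F s))) = c.
  have FE : lprod (d_s X s t) (d_t X s t) = F s := coefF_ruled t Is.
  have GE : lprod (d_t X s t) (d_t X s t) = 0 := coefG_ruled t Is.
  rewrite /tangent /Defs.coefE; move: (d_s X s t) (d_t X s t) FE GE => p q FE GE.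
  rewrite lprod_comb2 FE GE.
  field; exact: F0.
split.
  by exists 1, ((1 - Defs.coefE X s t) / (2 * F s)); rewrite tanE ltr01.
by exists 1, ((-1 - Defs.coefE X s t) / (2 * F s)); rewrite tanE ltrN10.
Qed.

Lemma lprod_lcross_ruled s t : I s ->
  lprod (lcross (d_s X s t) (d_t X s t)) (lcross (d_s X s t) (d_t X s t)) =
  F s ^+ 2.
Proof.
move=> Is.
have FE : lprod (d_s X s t) (d_t X s t) = F s := coefF_ruled t Is.
have GE : lprod (d_t X s t) (d_t X s t) = 0 := coefG_ruled t Is.
move: (d_s X s t) (d_t X s t) FE GE => p q FE GE.
by rewrite lprod_lcross2 FE GE mulr0 subr0.
Qed.

Lemma lnorm_lcross_ruled s t : I s ->
  lnorm (lcross (d_s X s t) (d_t X s t)) = `|F s|.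
Proof.
by move=> Is; rewrite /lnorm lprod_lcross_ruled// normrX sqrtr_sqr normr_id.
Qed.

Lemma lprod_unit_normal_ruled o s t (Y : 'rV[R]_3) : I s ->
  lprod (unit_normal o X s t) Y =
  (-1) ^+ o / `|F s| * det3 Y (gamma' s + t *: beta' s) (beta s).
Proof.
move=> Is; rewrite /unit_normal lnorm_lcross_ruled// !lprodZl lprod_lcross.
by rewrite d_s_ruled// d_t_ruled mulrA.
Qed.

Lemma epsilon_ruled o s t : I s -> F s != 0 -> epsilon o X s t = 1.
Proof.
move=> Is F0; rewrite /epsilon /unit_normal !(lprodZl, lprodZr).
rewrite lnorm_lcross_ruled// lprod_lcross_ruled// -(real_normK (num_real (F s))).
set e := (-1) ^+ o; have e2 : e ^+ 2 = 1 by rewrite sqrr_sign.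
transitivity (e ^+ 2 * (`|F s|^-1 * `|F s|) ^+ 2); first by ring.
by rewrite e2 mulVf ?normr_eq0// expr1n mul1r.
Qed.

(** [X_ss] is multiplied by [G = 0] and [X_tt] vanishes, so only the term in
    [X_st = beta'] contributes. *)
Lemma mean_curvature_ruled o s t : I s -> F s != 0 ->
  mean_curvature o X s t = - ((-1) ^+ o * mu s / `|F s|).
Proof.
move=> Is F0; rewrite /mean_curvature epsilon_ruled// gram_ruled// coefG_ruled//.
rewrite coefF_ruled// d_t_d_s_ruled// d_t_d_t_ruled.
rewrite (lprodC _ 0) lprod0l mulr0 (lprod_unit_normal_ruled o t (beta' s))//.
rewrite det3_ruled_velocity lightlike_frame_det//.
field; by rewrite F0 normr_eq0 F0.
Qed.

(** Clearing denominators uses that the sign of the normal and the mixed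
    product are their own inverses. *)
Lemma self_similar_ruledE o s t C : I s -> F s != 0 ->
  C * lprod (unit_normal o X s t) (X s t) = - (mean_curvature o X s t)^-1 <->
  C * (det3 (gamma s) (gamma' s) (beta s) + t * (mu s * lprod (gamma s) (beta s)))
  = mu s * F s ^+ 2.
Proof.
move=> Is F0; rewrite mean_curvature_ruled// lprod_unit_normal_ruled//.
have nF0 : `|F s| != 0 by rewrite normr_eq0.
have mu0 : mu s != 0 by rewrite -sqrf_eq0 lightlike_frame_det_sqr// oner_neq0.
have muV : (mu s)^-1 = mu s.
  by apply: (mulfI mu0); rewrite divff// -expr2 lightlike_frame_det_sqr.
have -> : det3 (X s t) (gamma' s + t *: beta' s) (beta s) =
  det3 (gamma s) (gamma' s) (beta s) + t * (mu s * lprod (gamma s) (beta s)).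
  by rewrite det3_ruled_position lightlike_frame_det// mulNr mulrN opprK.
have -> : - (- ((-1) ^+ o * mu s / `|F s|))^-1 =
          (-1) ^+ o / `|F s| * (mu s * F s ^+ 2).
  rewrite invrN opprK !invfM invrK muV invr_sign.
  by rewrite -(real_normK (num_real (F s))); field.
rewrite mulrCA; split=> [|->//]; apply: mulfI.
by rewrite mulf_neq0 ?signr_eq0 ?invr_eq0.
Qed.

(** * Base curves orthogonal to the rulings *)

Section Orthogonal.
Hypothesis gb : forall s, I s -> lprod (gamma s) (beta s) = 0.

Lemma orthogonal_coefF s : I s -> F s = - lprod (gamma s) (beta' s).
Proof.
move=> Is; have /eqP := lprod_leibniz_on oI smg smb gb Is.
by rewrite addr_eq0 => /eqP.
Qed.

Lemma orthogonal_frame s : I s ->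
  gamma s = - lprod (gamma s) (beta'' s) *: beta s
            + lprod (gamma s) (beta' s) *: beta' s.
Proof.
move=> Is; have [? ? ? ? ?] := lightlike_frame Is.
by apply: null_frame_coords => //; exact: gb.
Qed.

(** The [beta] component of [gamma] drops out of the determinant; its [beta']
    component is [- F], and the remaining determinant is [- mu F]. *)
Lemma orthogonal_det s : I s ->
  det3 (gamma s) (gamma' s) (beta s) = mu s * F s ^+ 2.
Proof.
move=> Is.
have -> : det3 (gamma s) (gamma' s) (beta s) =
          lprod (gamma s) (beta' s) * det3 (gamma' s) (beta s) (beta' s).
  by rewrite {1}orthogonal_frame// det3_null_position.
rewrite lightlike_frame_det// -[lprod _ (beta' s)]opprK -orthogonal_coefF//; ring.
Qed.

End Orthogonal.

Lemma self_expander_ruled (J : set R) o :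
  (forall s, I s -> lprod (gamma s) (beta s) = 0) ->
  (forall s, I s -> F s != 0) -> self_expander_IMCF I J o X 1.
Proof.
move=> gb F0; split=> [|s t Is _]; last by rewrite epsilon_ruled ?F0// mulr1 ltr01.
split; [exact: oner_neq0|exact: nondegenerate_ruled|move=> s t Is _].
split; last first.
  by apply/self_similar_ruledE; rewrite ?F0// gb// !mulr0 addr0 mul1r orthogonal_det.
rewrite mean_curvature_ruled ?F0// oppr_eq0.
rewrite !mulf_neq0 ?signr_eq0 ?invr_eq0 ?normr_eq0 ?F0//.
by rewrite -sqrf_eq0 lightlike_frame_det_sqr// oner_neq0.
Qed.

Lemma mixed_constant_sign : is_interval I ->
  (forall s, I s -> mu s = 1) \/ (forall s, I s -> mu s = - 1).
Proof.
move=> iI; apply: (sqr1_constant_sign (f := fun s => mu s)) => // s Is; last first.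
  exact: lightlike_frame_det_sqr.
have smb' := smooth_on_derive1 smb; have smb'' := smooth_on_derive1 smb'.
by apply: cvg_det3; apply: derivable_cont; apply: smooth_on_derivable Is.
Qed.

End RuledSurface.

(** * Orientation of the parameter and conclusion *)

(** Under [s -> -s] the first derivative changes sign and the second does
    not. *)
Lemma mixed_opp (R : realType) (I : set R) (beta : R -> 'rV[R]_3) (s : R) :
  open I -> smooth_on I beta -> I (- s) ->
  let beta_op := fun s => beta (- s) in
  mixed (derive1n 2 beta_op s) (beta_op s) (derive1 beta_op s) =
  - mixed (derive1n 2 beta (- s)) (beta (- s)) (derive1 beta (- s)).
Proof.
move=> oI smb Is /=.
have oNI : open [set s | I (- s)].
  by apply: open_comp => // x _; exact: opp_continuous.
have d1 x : I (- x) -> derive1 (fun s => beta (- s)) x = - derive1 beta (- x).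
  by move=> Ix; apply: derive1_opp; exact: smooth_on_derivable smb Ix.
rewrite (derive1_eq_on oNI (g := fun x => - derive1 beta (- x)))//.
have db : derivable (derive1 beta) (- s) 1.
  exact: smooth_on_derivable (smooth_on_derive1 smb) Is.
have -> : derive1 (fun x => - derive1 beta (- x)) s = derive1 (derive1 beta) (- s).
  have := @derive1_opp _ _ (- derive1 beta) s (derivableN db).
  by rewrite [in RHS]derive1E deriveN// -derive1E opprK.
by rewrite d1// !mixedE det3Nr.
Qed.

Unset Implicit Arguments.

Theorem theorem3p1 (R : realType) (I J : set R) (gamma beta : R -> 'rV[R]_3)
    (o : bool)
    (hI : open_interval I) (hJ : open_interval J)
    (hruled : ruled_data I gamma beta)
    (hbeta : lightlike_arclength I beta) :
  (forall C : R,
     non_cylindrical I beta ->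
     nondegenerate_surface I J (ruled gamma beta) ->
     self_similar_IMCF I J o (ruled gamma beta) C ->
     [/\ [/\ timelike_surface I J (ruled gamma beta),
             self_expander_IMCF I J o (ruled gamma beta) C & C = 1],
         exists a b : R -> R,
           [/\ smooth_on I a, smooth_on I b &
               frame_decomposition I gamma beta a b]
       & unit_mixed_oriented I beta])
  /\
  (forall a b : R -> R,
     frame_decomposition I gamma beta a b ->
     unit_mixed I beta ->
     timelike_surface I J (ruled gamma beta) /\
     self_expander_IMCF I J o (ruled gamma beta) 1).
Proof.
have [oI iI [s0 Is0]] := hI; have [oJ _ [t0 Jt0]] := hJ.
have [smg smb _] := hruled.
have frame s (Is : I s) := lightlike_frame oI smb hbeta Is.
split=> [C _ nd [C0 _ eqC]|a b dec _]; last first.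
  have gb s : I s -> lprod (gamma s) (beta s) = 0.
    move=> Is; have [_ ->] := dec s Is; have [uu uv _ _ _] := frame s Is.
    by rewrite lprodDl !lprodZl uu lprodC uv !mulr0 addr0.
  have F0 s : I s -> lprod (derive1 gamma s) (beta s) != 0.
    move=> Is; rewrite (orthogonal_coefF oI smg smb gb)//.
    have [b0 ->] := dec s Is; have [_ uv vv _ _] := frame s Is.
    by rewrite lprodDl !lprodZl uv vv mulr0 add0r mulr1 oppr_eq0.
  by split; [exact: timelike_ruled|exact: self_expander_ruled].
have F0 s : I s -> lprod (derive1 gamma s) (beta s) != 0.
  move=> Is; have := nd s t0 Is Jt0.
  by rewrite (gram_ruled oI)// oppr_eq0 expf_eq0.
have mu2 s (Is : I s) := lightlike_frame_det_sqr oI smb hbeta Is.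
(* [J] is open, so it has a second point besides [t0]. *)
have [t1 Jt1 t10] : exists2 t1, J t1 & t1 != t0.
  have /nbhs_ballP[e /= e0 eJ] : nbhs t0 J by exact: open_nbhs_nbhs.
  exists (t0 + e / 2); last by rewrite -subr_eq0 addrAC subrr add0r gt_eqF ?divr_gt0.
  apply: eJ; rewrite /ball /= opprD addrA subrr add0r normrN gtr0_norm ?divr_gt0//.
  by rewrite ltr_pdivrMr// ltr_pMr// ltr1n.
have eqn s t (Is : I s) (Jt : J t) :=
  (self_similar_ruledE oI smg smb hbeta o t C Is (F0 s Is)).1 (eqC s t Is Jt).2.
(* Subtract the equations at [t0] and [t1], where only the term linear in
   [t] differs. *)
have gb s : I s -> lprod (gamma s) (beta s) = 0.
  move=> Is; apply/eqP; have /eqP := eqn s t1 Is Jt1.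
  rewrite -(eqn s t0 Is Jt0) -subr_eq0 -mulrBr opprD addrACA subrr add0r -mulrBl.
  rewrite !mulf_eq0 (negPf C0) subr_eq0 (negPf t10) /=.
  by rewrite -[det3 _ _ _ == 0]sqrf_eq0 mu2// oner_eq0.
have C1 : C = 1.
  have := eqn s0 t0 Is0 Jt0.
  rewrite gb// !mulr0 addr0 (orthogonal_det oI)//.
  rewrite -[RHS]mul1r; apply: mulIf.
  by rewrite mulf_neq0 ?expf_neq0 ?F0// -sqrf_eq0 mu2// oner_neq0.
split; first by rewrite C1; split => //; [exact: timelike_ruled|exact: self_expander_ruled].
  exists (fun s => lprod (- gamma s) (derive1 (derive1 beta) s)).
  exists (fun s => lprod (gamma s) (derive1 beta s)).
  have smb' := smooth_on_derive1 smb.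
  split; first exact: smooth_on_lprod (smooth_onN oI smg) (smooth_on_derive1 smb').
    exact: smooth_on_lprod.
  move=> s Is; split; last by rewrite lprodNl; exact: (orthogonal_frame oI smb hbeta gb).
  by rewrite -oppr_eq0 -(orthogonal_coefF oI smg smb gb)// F0.
have [mu1|muN1] := mixed_constant_sign oI smb hbeta iI; [left|right] => s Is.
  by rewrite mixedE; exact: mu1.
by rewrite (mixed_opp oI)// mixedE muN1 ?opprK.
Qed.
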